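(* Fix $h$, and let $C$ be a weakly sequentially compact subset of $H$. Let $\mathcal{F}^0$ be the feasible set of $(\mathrm{McC}_h)$ and let $(\mathcal{F}^n)_{n}$ be any sequence of sets produced by the bound-tightening procedure (OBBT) described in the context, started with $\mathcal{F}^0$. Let $m_n$ denote the optimal objective value of $$(\mathrm{McC}_h^n)\qquad \min_{u,w,z_1,\dots,z_{N_h}}\ j(u,w)+\alpha\,\mathrm{TV}(w)\quad\text{s.t.}\quad(u,w,z_1,\dots,z_{N_h})\in\mathcal{F}^n .$$ Let $m_{\mathrm{OCP}}$ be the infimum of $(\mathrm{OCP})$, $(\bar u,\bar w)$ the minimizer of $(\mathrm{OCP})$, and $\bar u_h\in U$ the corresponding solution of $A\bar u_h+(P_h\bar u_h)(P_h\bar w)=f$. Then for all $n\in\mathbb{N}$ $$m_{\mathrm{OCP}}\ \ge\ m_n-L_u\|\bar u-\bar u_h\|_U ,$$ where $L_u$ is the Lipschitz constant of $j$ with respect to its first argument on the feasible set of $(\mathrm{McC}_h)$. Moreover, the sequence $(m_n)_n$ is monotonically nondecreasing.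
   Context: Setting. $\Omega\subset\mathbb{R}^d$ is a bounded domain, $H:=L^2(\Omega)$, and the control space is $W:=BV(\Omega)$; $\mathrm{TV}$ is the total variation seminorm, with $\mathrm{TV}(w)=+\infty$ if $w\in L^1(\Omega)\setminus BV(\Omega)$. $U$ is a reflexive Banach space compactly embedded into $H$; identifying $H\cong H^*$ one has compact embeddings $U\hookrightarrow H\cong H^*\hookrightarrow U^*$. $A:U\to U^*$ is linear and bounded with bounded inverse, $f\in U^*$, $\alpha>0$, $j:U\times H\to\mathbb{R}$ is Lipschitz continuous on bounded sets, and $C\subset H$ is nonempty, bounded, closed and convex. For all $(u,w)\in U\times W$ the product $uw$ is a measurable function that is also an element of $U^*$. The state equation $Au+uw=f$ is assumed to have a unique solution $u\in U$ for a given control $w\in C\cap W$. $(\mathrm{OCP})$: minimize $j(u,w)+\alpha\,\mathrm{TV}(w)$ over states $u\in U$ and controls $w\in C$ (the control space being $W$) subject to $Au+uw=f$ in $U^*$. Bounds. There are $u_\ell,u_u\in H$ and $w_\ell,w_u\in L^\infty(\Omega)$ such that $u_\ell\le u\le u_u$ and $w_\ell\le w\le w_u$ a.e. for all $(u,w)\in U\times W$ with $Au+uw=f$ and $w\in C$. Partitions and averaging. For each $h$ from a sequence of mesh sizes, $\mathcal{Q}_h=\{Q_h^1,\dots,Q_h^{N_h}\}$ is a partition of $\Omega$ into intervals ($d=1$), squares ($d=2$), cubes ($d=3$), and so on, with mesh size $h$, and $P_hg:=\sum_{i=1}^{N_h}\frac{1}{|Q_h^i|}\int_{Q_h^i}g\,dx\;\chi_{Q_h^i}$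 for $g\in L^1(\Omega)$. It is assumed that: (a) for every $w\in BV(\Omega)$ with $w_\ell\le w\le w_u$ a.e. the equation $Au+(P_hu)(P_hw)=f$ has a unique solution $u\in U$; (b) there are real numbers $u_\ell^i,u_u^i,w_\ell^i,w_u^i$ (depending on $h$ and $i$) such that $u_\ell^i\le(P_hu)|_{Q_h^i}\le u_u^i$ and $w_\ell^i\le(P_hw)|_{Q_h^i}\le w_u^i$ for all $i$ and for all $w\in C$ with $w_\ell\le w\le w_u$ a.e. and $u\in U$ that solve $Au+(P_hu)(P_hw)=f$. $(\mathrm{McC}_h)$: minimize $j(u,w)+\alpha\,\mathrm{TV}(w)$ over $u\in U$, $w\in C$ with $w_\ell\le w\le w_u$ a.e., and $(z_1,\dots,z_{N_h})\in\mathbb{R}^{N_h}$, subject to $Au+\sum_{i=1}^{N_h}z_i\chi_{Q_h^i}=f$ in $U^*$ and, for every $i\in\{1,\dots,N_h\}$, on $Q_h^i$ (where $P_hu,P_hw$ are constant): $z_i\ge u_\ell^iP_hw+(P_hu)w_\ell^i-u_\ell^iw_\ell^i$, $z_i\ge u_u^iP_hw+(P_hu)w_u^i-u_u^iw_u^i$, $z_i\le u_u^iP_hw+(P_hu)w_\ell^i-u_u^iw_\ell^i$, $z_i\le u_\ell^iP_hw+(P_hu)w_u^i-u_\ell^iw_u^i$, $u_\ell^i\le P_hu\le u_u^i$. OBBT procedure. For $n=1,2,\dots$: choose an arbitrary $i\in\{1,\dots,N_h\}$ and an arbitrary $s\in\{\ell,u\}$; if $s=\ell$ let $\tilde u_\ell^i:=\min\{(P_hu)|_{Q_h^i}:(u,w,z)\in\mathcal{F}^{n-1}\}$,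 and if $s=u$ let $\tilde u_u^i:=\max\{(P_hu)|_{Q_h^i}:(u,w,z)\in\mathcal{F}^{n-1}\}$; let $\mathcal{F}^n$ be the set defined by the same constraints as $\mathcal{F}^{n-1}$ but with the bound $u_s^i$ replaced by $\tilde u_s^i$ everywhere it occurs (including in the inequalities for $z_i$), all other bounds being kept.
   Formalization: L_u is taken as a Lipschitz constant of j in its first argument on the feasible set of (McC_h) enlarged by the single pair (ū, w̄); on the feasible set alone the estimate is false, since (ū, w̄) need not be feasible there. *)

(* Defs.v *)
From HB Require Import structures.
From mathcomp Require Import all_boot all_order all_algebra.
From mathcomp Require Import all_classical all_reals all_analysis.
From mathcomp Require Import measurable_realfun.

Set Implicit Arguments.
Unset Strict Implicit.
Unset Printing Implicit Defensive.

Import Order.TTheory GRing.Theory Num.Theory.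
Import numFieldNormedType.Exports.

Local Open Scope classical_set_scope.
Local Open Scope ring_scope.

Definition borel_display : measure_display. Proof. exact. Qed.

Section borel_rV.
Context (R : realType) (n : nat).

Let borel : set (set 'rV[R]_n) := <<s open >>.

Let borel0 : borel set0. Proof. exact: sigma_algebra0. Qed.

Let borelC X : borel X -> borel (~` X). Proof. exact: sigma_algebraC. Qed.

Let borel_bigcup (F : (set 'rV[R]_n)^nat) :
  (forall i, borel (F i)) -> borel (\bigcup_i F i).
Proof. exact: sigma_algebra_bigcup. Qed.

HB.instance Definition _ := @isMeasurable.Build borel_display 'rV[R]_n
  borel borel0 borelC borel_bigcup.

Lemma open_measurable_rV (X : set 'rV[R]_n) : open X -> measurable X.
Proof. by move=> oX; exact: sub_sigma_algebra. Qed.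

End borel_rV.

Lemma sigma_finite_product d1 d2 (T1 : measurableType d1)
    (T2 : measurableType d2) (R : realType)
    (m1 : {sigma_finite_measure set T1 -> \bar R})
    (m2 : {sigma_finite_measure set T2 -> \bar R}) :
  sigma_finite setT (m1 \x m2)%E.
Proof.
have /sigma_finiteP[F [TF ndF Foo]] := sigma_finiteT m1.
have /sigma_finiteP[G [TG ndG Goo]] := sigma_finiteT m2.
exists (fun n => F n `*` G n).
  rewrite -setXTT TF TG predeqE => -[x y]; split; last first.
    by move=> [n _ []/= ? ?]; split; exists n.
  move=> [/= [n _ Fnx] [k _ Gky]]; exists (maxn n k) => //; split.
  - by move: x Fnx; exact/subsetPset/ndF/leq_maxl.
  - by move: y Gky; exact/subsetPset/ndG/leq_maxr.
move=> k; have [? ?] := Foo k; have [? ?] := Goo k.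
split; first exact: measurableX.
by rewrite product_measure1E// lte_mul_pinfty// ge0_fin_numE.
Qed.

Section lebesgue_rV.
Context (R : realType).

Definition cons_rV n (p : measurableTypeR R * 'rV[R]_n) : 'rV[R]_n.+1 :=
  row_mx (p.1)%:M p.2.

Definition uncons_rV n (v : 'rV[R]_n.+1) : measurableTypeR R * 'rV[R]_n :=
  (v ord0 ord0, \row_i v ord0 (lift ord0 i)).

Lemma cons_rV0 n (p : R * 'rV[R]_n) : cons_rV p ord0 ord0 = p.1.
Proof.
rewrite /cons_rV (_ : ord0 = @lshift 1 n ord0); last exact: val_inj.
by rewrite (@row_mxEl R 1 1 n) mxE eqxx.
Qed.

Lemma cons_rVS n (p : R * 'rV[R]_n) i :
  cons_rV p ord0 (lift ord0 i) = p.2 ord0 i.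
Proof.
rewrite /cons_rV (_ : lift ord0 i = @rshift 1 n i); last exact: val_inj.
by rewrite (@row_mxEr R 1 1 n).
Qed.

Lemma cons_rVK n : cancel (@cons_rV n) (@uncons_rV n).
Proof.
move=> [x v]; rewrite /uncons_rV cons_rV0; congr pair.
by apply/rowP => i; rewrite mxE cons_rVS.
Qed.

Lemma uncons_rVK n : cancel (@uncons_rV n) (@cons_rV n).
Proof.
move=> v; apply/rowP => i; case: (unliftP ord0 i) => [k|] ->.
  by rewrite cons_rVS mxE.
by rewrite cons_rV0.
Qed.

Lemma measurable_cons_rV n :
  measurable_fun [set: measurableTypeR R * 'rV[R]_n] (@cons_rV n).
Proof.
apply: (measurability (@open 'rV[R]_n.+1)) => [//|_ [X oX <-]]; rewrite setTI.
pose bx (t : rat * 'rV[rat]_n * nat) : set (measurableTypeR R * 'rV[R]_n) :=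
  ball (ratr t.1.1 : R) t.2.+1%:R^-1 `*`
  ball (map_mx ratr t.1.2 : 'rV[R]_n) t.2.+1%:R^-1.
pose bxn m := if unpickle m is Some t then bx t else set0.
suff -> : @cons_rV n @^-1` X =
    \bigcup_(m in [set m | bxn m `<=` @cons_rV n @^-1` X]) bxn m.
  apply: bigcup_measurable => m _; rewrite /bxn; case: unpickle => // t.
  apply: measurableX; first by apply: open_measurable; exact: ball_open.
  by apply: open_measurable_rV; exact: ball_open.
suff sub p : X (cons_rV p) ->
    exists2 t, bx t `<=` @cons_rV n @^-1` X & bx t p.
  apply/seteqP; split=> [p /sub[t tX tp]|p [m mX mp]]; last exact: mX.
  by exists (pickle t); rewrite /= /bxn pickleK.
move=> Xp.
have [e /= e0 eX] : nbhs_ball (cons_rV p) X.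
  by apply/nbhs_ballP; exact: open_nbhs_nbhs.
have [k ke] : exists k, k.+1%:R^-1 < e / 2.
  have [k _ /(_ k (leqnn k)) ke] :=
    near_infty_natSinv_lt (PosNum (divr_gt0 e0 (ltr0Sn R 1))).
  by exists k.
have rat_near (x : R) : exists q : rat, `|ratr q - x| < k.+1%:R^-1.
  have x0 : x - k.+1%:R^-1 < x + k.+1%:R^-1.
    by rewrite ltrBlDr -addrA ltrDl addr_gt0.
  have [q] := rat_in_itvoo x0; rewrite in_itv/= => /andP[h1 h2]; exists q.
  by rewrite ltr_distl h1.
have [q qp] := rat_near p.1.
have [w wp] : exists w : 'rV[rat]_n,
    forall i, `|ratr (w ord0 i) - p.2 ord0 i| < k.+1%:R^-1.
  have [g gP] := choice (fun i => rat_near (p.2 ord0 i)).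
  by exists (\row_i g i) => i; rewrite mxE.
exists (q, w, k); last first.
  by split => //=; split=> // i l; rewrite ord1 mxE; exact: wp.
move=> [x v] [/= qx [_ wv]]; apply: eX; split=> // i l; rewrite ord1.
case: (unliftP ord0 l) => [l' ->|->].
  have := wv ord0 l'; rewrite !cons_rVS mxE -!ball_normE /= => {}wv.
  rewrite (le_lt_trans (ler_distD (ratr (w ord0 l')) _ _))// [ltRHS](splitr e).
  by rewrite ltrD ?(lt_trans wv)// distrC (lt_trans (wp _)).
move: qx; rewrite !cons_rV0 -!ball_normE /= => qx.
rewrite (le_lt_trans (ler_distD (ratr q) _ _))// [ltRHS](splitr e).
by rewrite ltrD ?(lt_trans qx)// distrC (lt_trans qp).
Qed.

Lemma measurable_uncons_rV n : measurable_fun [set: 'rV[R]_n.+1]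
  (@uncons_rV n : _ -> measurableTypeR R * 'rV[R]_n).
Proof.
apply: measurable_fun_pair => /=.
  apply: (measurability _ (RGenOpens.measurableE R)) => _ [_ [a [b ->]] <-].
  rewrite setTI; apply: open_measurable_rV; apply: open_comp => //.
  by move=> x _; exact: coord_continuous.
apply: (measurability (@open 'rV[R]_n)) => [//|_ [X oX <-]]; rewrite setTI.
apply: open_measurable_rV; apply: open_comp => // v _.
move=> Y /nbhs_ballP[e e0 eY]; apply/nbhs_ballP; exists e => // w [_ vw].
by apply: eY; split=> // i l; rewrite !mxE; exact: vw.
Qed.

Section cons_measure.
Context n (mu : {sigma_finite_measure set 'rV[R]_n -> \bar R}).
Local Open Scope ereal_scope.

Definition cons_measure : set 'rV[R]_n.+1 -> \bar R :=
  pushforward (lebesgue_measure \x mu) (@cons_rV n).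

Let measurable_preimage (X : set 'rV[R]_n.+1) : measurable X ->
  measurable (@cons_rV n @^-1` X).
Proof.
by move=> mX; rewrite -[X in measurable X]setTI; exact: measurable_cons_rV.
Qed.

Let cons_measure0 : cons_measure set0 = 0.
Proof. by rewrite /cons_measure /pushforward preimage_set0 measure0. Qed.

Let cons_measure_ge0 X : 0 <= cons_measure X.
Proof. by rewrite /cons_measure /pushforward measure_ge0. Qed.

Let cons_measure_sigma_additive : semi_sigma_additive cons_measure.
Proof.
move=> F mF tF mUF; rewrite /cons_measure /pushforward preimage_bigcup.
apply: measure_semi_sigma_additive.
- by move=> k; exact: measurable_preimage.
- apply/trivIsetP => /= i j _ _ ij; rewrite -preimage_setI.
  by move/trivIsetP : tF => /(_ _ _ _ _ ij) ->//; rewrite preimage_set0.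
- by rewrite -preimage_bigcup; exact: measurable_preimage.
Qed.

HB.instance Definition _ := isMeasure.Build _ _ _ cons_measure
  cons_measure0 cons_measure_ge0 cons_measure_sigma_additive.

Let cons_measure_sigma_finite : sigma_finite setT cons_measure.
Proof.
have [F FT Foo] : sigma_finite setT (lebesgue_measure \x mu).
  exact: (@sigma_finite_product _ _ _ _ _ (@lebesgue_measure R) mu).
exists (fun k => @uncons_rV n @^-1` F k).
  by rewrite -preimage_bigcup -FT preimage_setT.
move=> k; have [mF Fk] := Foo k; split.
  by rewrite -[X in measurable X]setTI; exact: measurable_uncons_rV.
rewrite /cons_measure /pushforward -comp_preimage.
by rewrite (_ : _ \o _ = id)//; apply/funext => p; exact: cons_rVK.
Qed.

HB.instance Definition _ := Measure_isSigmaFinite.Build _ _ _ cons_measure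
  cons_measure_sigma_finite.

End cons_measure.

(* Lebesgue measure on [R^n], as the [n]-fold product of [lebesgue_measure]. *)
Fixpoint lebesgue_rV n : {sigma_finite_measure set 'rV[R]_n -> \bar R} :=
  match n with
  | 0 => \d_(0 : 'rV[R]_0)
  | n'.+1 => cons_measure (lebesgue_rV n')
  end.

End lebesgue_rV.

Record bounded_domain (R : realType) (d : nat) := BoundedDomain {
  domain_set :> set 'rV[R]_d ;
  domain_open : open domain_set ;
  domain_connected : connected domain_set ;
  domain_bounded : bounded_set domain_set ;
  domain_nonempty : domain_set !=set0 }.
Arguments domain_open {R d} b.

Section function_spaces.
Context (R : realType) (d : nat) (Omega : bounded_domain R d).

Definition domain_measure : {measure set 'rV[R]_d -> \bar R} :=
  mrestr (lebesgue_rV R d) (open_measurable_rV (domain_open Omega)).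

(* Elements of Lebesgue spaces are given by representatives on the whole of
   [R^d]; their values outside [Omega] are irrelevant, and every notion below
   only depends on their class modulo equality a.e. in [Omega]. *)
Definition L2 := LfunType domain_measure (lee1n 2).
Definition Linfty := LfunType domain_measure (leey 1).

HB.instance Definition _ := GRing.Lmodule.on L2.

Definition L2norm (w : L2) : R := fine ('N[domain_measure]_2[EFin \o w])%E.

Definition ae_between (l u g : 'rV[R]_d -> R) :=
  {ae domain_measure, forall x, l x <= g x <= u x}.

Definition divergence (phi : 'rV[R]_d -> 'rV[R]_d) (x : 'rV[R]_d) : R :=
  \sum_(i < d) ('D_(delta_mx ord0 i) phi x) ord0 i.

Definition test_field (phi : 'rV[R]_d -> 'rV[R]_d) :=
  [/\ forall i x, derivable phi x (delta_mx ord0 i),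
      forall i, continuous (fun x => 'D_(delta_mx ord0 i) phi x),
      compact (closure [set x | phi x != 0]),
      closure [set x | phi x != 0] `<=` Omega &
      forall x, \sum_(i < d) phi x ord0 i ^+ 2 <= 1].

Definition TV (g : 'rV[R]_d -> R) : \bar R :=
  ereal_sup [set \int[domain_measure]_x (g x * divergence phi x)%:E
            | phi in test_field]%E.

Definition BV (g : 'rV[R]_d -> R) :=
  g \in Lfun domain_measure 1 /\ (TV g < +oo)%E.

Definition L2_closed (C : set L2) :=
  forall w, (forall e, 0 < e -> exists2 w', C w' & L2norm (w - w') < e) -> C w.

Definition L2_bounded (C : set L2) := exists r, forall w, C w -> L2norm w <= r.

Definition L2_convex (C : set L2) := forall w w' (t : R),
  C w -> C w' -> 0 <= t <= 1 -> C (t *: w + (1 - t) *: w').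

Definition L2_weakly_cvg (w : nat -> L2) (w' : L2) :=
  forall l : {linear L2 -> R^o}, (exists K, forall v, `|l v| <= K * L2norm v) ->
  (fun k => l (w k)) @ \oo --> l w'.

Definition L2_weakly_sequentially_compact (C : set L2) :=
  forall w : nat -> L2, (forall k, C (w k)) ->
  exists (s : nat -> nat) (w' : L2),
    [/\ {homo s : m n / (m < n)%N}, C w' & L2_weakly_cvg (w \o s) w'].

End function_spaces.

Record dual (R : realType) (U : normedModType R) := Dual {
  dual_fun :> {linear U -> R^o} ;
  dual_continuous : continuous dual_fun }.

Section dual_space.
Context (R : realType) (U : normedModType R).

Definition dual_norm (l : dual U) : R :=
  sup [set `|l v| | v in [set v : U | `|v| <= 1]].

Definition reflexive_space :=
  forall Phi : dual U -> R,
    (forall a (l1 l2 l3 : dual U), (forall v, l3 v = a * l1 v + l2 v) ->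
      Phi l3 = a * Phi l1 + Phi l2) ->
    (exists K, forall l, `|Phi l| <= K * dual_norm l) ->
  exists u : U, forall l : dual U, Phi l = l u.

Definition linear_to_dual (A : U -> dual U) :=
  forall a u u' v, A (a *: u + u') v = a * A u v + A u' v.

Definition bounded_to_dual (A : U -> dual U) :=
  exists K, forall u, dual_norm (A u) <= K * `|u|.

Definition has_bounded_inverse (A : U -> dual U) :=
  exists B : dual U -> U,
    [/\ forall u, B (A u) = u, forall l v, A (B l) v = l v &
        exists K, forall l, `|B l| <= K * dual_norm l].

End dual_space.

Section control.
Context (R : realType) (d : nat) (Omega : bounded_domain R d).
Context (U : completeNormedModType R) (iota : U -> L2 Omega).

Local Notation mu := (domain_measure Omega).

(* Linearity and injectivity are those of the map from [U] to classes modulo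
   equality a.e. in [Omega]. *)
Definition compact_embedding :=
  [/\ forall a u v, iota (a *: u + v) = a *: iota u + iota v %[ae mu],
      forall u, iota u = (cst 0 : 'rV[R]_d -> R) %[ae mu] -> u = 0,
      exists K, forall u, L2norm (iota u) <= K * `|u| &
      forall u : nat -> U, (exists r, forall k, `|u k| <= r) ->
        exists (s : nat -> nat) (g : L2 Omega),
          {homo s : m n / (m < n)%N} /\
          (fun k => L2norm (iota (u (s k)) - g)) @ \oo --> (0 : R)].

Definition lipschitz_on_bounded_sets (j : U -> L2 Omega -> R) :=
  forall r, exists L, forall u u' w w',
    `|u| <= r -> `|u'| <= r -> L2norm w <= r -> L2norm w' <= r ->
    `|j u w - j u' w'| <= L * (`|u - u'| + L2norm (w - w')).

(* A function [g] acts on [U] through the pivot space [L2 Omega]. *)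
Definition pairing (g : 'rV[R]_d -> R) (v : U) : R :=
  \int[mu]_x (g x * iota v x).

Definition in_dual (g : 'rV[R]_d -> R) :=
  (forall v, mu.-integrable setT (EFin \o (g \* iota v))) /\
  (exists K, forall v, `|pairing g v| <= K * `|v|).

Variables (A : U -> dual U) (f : dual U).

(* A u + g = f in the dual of [U] *)
Definition solves (u : U) (g : 'rV[R]_d -> R) :=
  forall v, A u v + pairing g v = f v.

Variables (j : U -> L2 Omega -> R) (alpha : R) (C : set (L2 Omega)).

Definition objective (u : U) (w : L2 Omega) : \bar R :=
  ((j u w)%:E + alpha%:E * TV Omega w)%E.

Definition OCP_feasible : set (U * L2 Omega) :=
  [set p | [/\ C p.2, BV Omega p.2 & solves p.1 (iota p.1 \* p.2)]].

Definition OCP_value : \bar R :=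
  ereal_inf [set objective p.1 p.2 | p in OCP_feasible].

Definition OCP_minimizer (u : U) (w : L2 Omega) :=
  OCP_feasible (u, w) /\
  forall p, OCP_feasible p -> (objective u w <= objective p.1 p.2)%E.

End control.

(* The faces of a cell are left unspecified, so that an open [Omega] can be
   partitioned exactly. *)
Definition is_cube (R : realType) (d : nat) (s : R) (X : set 'rV[R]_d) :=
  exists a : 'rV[R]_d,
    [set x : 'rV[R]_d | forall k, a ord0 k < x ord0 k < a ord0 k + s] `<=` X /\
    X `<=` [set x : 'rV[R]_d | forall k, a ord0 k <= x ord0 k <= a ord0 k + s].

(* The mesh size is the largest edge length. *)
Definition cube_partition (R : realType) (d : nat) (Omega : bounded_domain R d)
    (h : R) (N : nat) (Q : 'I_N -> set 'rV[R]_d) :=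
  [/\ forall i, measurable (Q i), trivIset setT Q,
      \bigcup_i Q i = Omega &
      exists s : 'I_N -> R,
        (forall i, 0 < s i <= h /\ is_cube (s i) (Q i)) /\
        (exists i, s i = h)].

Section mccormick.
Context (R : realType) (d : nat) (Omega : bounded_domain R d).
Context (N : nat) (Q : 'I_N -> set 'rV[R]_d).

Definition average (g : 'rV[R]_d -> R) (i : 'I_N) : R :=
  (fine (lebesgue_rV R d (Q i)))^-1 * \int[lebesgue_rV R d]_(x in Q i) g x.

Definition step_function (z : 'I_N -> R) (x : 'rV[R]_d) : R :=
  \sum_(i < N) z i * \1_(Q i) x.

Definition P_h (g : 'rV[R]_d -> R) : 'rV[R]_d -> R := step_function (average g).

Context (U : completeNormedModType R) (iota : U -> L2 Omega).
Variables (A : U -> dual U) (f : dual U).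
Variables (C : set (L2 Omega)) (w_l w_u : Linfty Omega) (wlo wup : 'I_N -> R).

(* [average (iota u) i] and [average w i] are the values on [Q i] of
   [P_h (iota u)] and [P_h w]. *)
Definition McC_feasible (ulo uup : 'I_N -> R) :
    set (U * L2 Omega * 'rV[R]_N) :=
  [set p : U * L2 Omega * 'rV[R]_N | let: (u, w, z) := p in
    [/\ C w, ae_between Omega w_l w_u w,
        solves iota A f u (step_function (fun i => z ord0 i)) &
        forall i, let Pu := average (iota u) i in let Pw := average w i in
        [/\ z ord0 i >= ulo i * Pw + Pu * wlo i - ulo i * wlo i,
            z ord0 i >= uup i * Pw + Pu * wup i - uup i * wup i,
            z ord0 i <= uup i * Pw + Pu * wlo i - uup i * wlo i,
            z ord0 i <= ulo i * Pw + Pu * wup i - ulo i * wup i &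
            ulo i <= Pu <= uup i]]].

Definition McC_value (j : U -> L2 Omega -> R) (alpha : R) (ulo uup : 'I_N -> R) :
    \bar R :=
  ereal_inf [set objective j alpha p.1.1 p.1.2 | p in McC_feasible ulo uup].

Definition is_minimum (S : set R) (m : R) := S m /\ lbound S m.
Definition is_maximum (S : set R) (m : R) := S m /\ ubound S m.

Definition OBBT_step (ulo uup ulo' uup' : 'I_N -> R) :=
  exists i,
    let values := [set average (iota p.1.1) i | p in McC_feasible ulo uup] in
    [/\ is_minimum values (ulo' i), forall k, k != i -> ulo' k = ulo k &
        forall k, uup' k = uup k] \/
    [/\ is_maximum values (uup' i), forall k, k != i -> uup' k = uup k &
        forall k, ulo' k = ulo k].

Definition OBBT_sequence (ulo0 uup0 : 'I_N -> R) (ulo uup : nat -> 'I_N -> R) :=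
  [/\ ulo 0%N = ulo0, uup 0%N = uup0 &
      forall n, OBBT_step (ulo n) (uup n) (ulo n.+1) (uup n.+1)].

End mccormick.

(* Main.v *)
Require Import Defs.
From mathcomp Require Import all_boot all_order all_algebra.
From mathcomp Require Import all_classical all_reals all_analysis.
From mathcomp Require Import measurable_realfun lra.

(** The proof rests on two features of the McCormick inequalities.

    They are valid for the true product.  If [a <= x <= b] and [c <= y <= e],
    then each of the four inequalities for [z = x * y] is the nonnegativity of a
    product of two distances to the bounds ([mccormick_valid]).  Hence the
    discretized state [u_h] of the optimal control [w], with [z_i] the product
    of the averages of [u_h] and [w] over the cell [Q_i], is feasible for the
    relaxation as soon as the averages obey the bounds ([McC_feasible_average]).
    Tightening never removes this point: a new bound is the minimum or maximum
    of an average over a feasible set which contains the point, so the averages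
    of [u_h] obey the new bound as well, and the true product then satisfies the
    new inequalities too ([OBBT_keeps_average]).  Therefore [m_n] is at most the
    objective at [(u_h, w)], which has the same total variation term as
    [(u, w)] and differs in [j] by at most [L_u * |u - u_h|].

    They are monotone in the bounds of [u], provided that the average of the
    control lies between its own bounds ([mccormick_relax]).  Points of a
    tightened relaxation with that property thus satisfy the previous
    constraints ([McC_feasible_relax]).  The bounds of the averages are known
    only for controls with a discretized state, for instance those in [BV]; but
    a feasible control outside [BV] has infinite total variation
    ([BV_of_TV_lty], as the domain has finite measure), so its objective is
    infinite and it cannot lower the optimal value. *)

Set Implicit Arguments.
Unset Strict Implicit.
Unset Printing Implicit Defensive.

Import Order.TTheory GRing.Theory Num.Theory.
Import numFieldNormedType.Exports.
Local Open Scope classical_set_scope.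
Local Open Scope ring_scope.

(** * Finite measure of the domain *)

(** In the sup norm, a ball of [R^(n+1)] is a product of an interval and a ball
    of [R^n]. *)
Lemma lebesgue_rV_ball_lty (R : realType) (n : nat) (r : R) :
  (lebesgue_rV R n (ball (0%R : 'rV[R]_n) r) < +oo)%E.
Proof.
elim: n => [|n IH].
  by rewrite /= diracE ltry.
have [r0|r0] := leP r 0.
  rewrite (_ : ball _ r = set0) ?measure0 ?ltry//.
  by rewrite -subset0 => x []; rewrite ltNge r0.
have mB k : measurable (ball (0 : 'rV[R]_k) r).
  by apply: open_measurable_rV; exact: ball_open.
have mB1 : measurable (ball (0 : measurableTypeR R) r).
  by apply: open_measurable; exact: ball_open.
have lB1 : (@lebesgue_measure R (ball 0%R r) < +oo)%E.
  by rewrite lebesgue_measure_ball ?ltW// ltry.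
rewrite [ltLHS]/= /cons_measure /pushforward.
rewrite (_ : _ @^-1` _ =
    (ball (0 : measurableTypeR R) r : set (measurableTypeR R)) `*`
    ball (0 : 'rV[R]_n) r).
  rewrite product_measure1E//; last exact: mB.
  by apply: lte_mul_pinfty => //; rewrite ge0_fin_numE.
apply/seteqP; split=> [[x v] [_ xv]|[x v] [/= xr [_ vr]]].
  split.
    by have := xv ord0 ord0; rewrite cons_rV0 mxE.
  split=> // i k; rewrite ord1.
  by have := xv ord0 (lift ord0 k); rewrite cons_rVS !mxE.
split=> // i k; rewrite ord1 mxE.
case: (unliftP ord0 k) => [k' ->|->]; last by rewrite cons_rV0.
by rewrite cons_rVS; have := vr ord0 k'; rewrite mxE.
Qed.

Lemma domain_measure_fin_num (R : realType) (d : nat)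
    (Omega : bounded_domain R d) :
  domain_measure Omega setT \is a fin_num.
Proof.
rewrite ge0_fin_numE// /domain_measure /mrestr /= /mrestr setTI.
have [M OM] : exists M, globally Omega [set x | `|x| <= M].
  have [M [_ OM]] := domain_bounded Omega.
  by exists (M + 1); apply: OM; rewrite ltrDl.
apply: le_lt_trans (@lebesgue_rV_ball_lty R d (M + 1)).
apply: le_measure; rewrite ?inE.
- by apply: open_measurable_rV; exact: domain_open.
- by apply: open_measurable_rV; exact: ball_open.
move=> x /OM xM; rewrite -ball_normE /= sub0r normrN.
by rewrite (le_lt_trans xM)// ltrDl.
Qed.

Lemma BV_of_TV_lty (R : realType) (d : nat) (Omega : bounded_domain R d)
    (w : L2 Omega) : (TV Omega w < +oo)%E -> BV Omega w.
Proof.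
split=> //; apply: (Lfun_subset12 (domain_measure_fin_num Omega)).
exact: LfunP.
Qed.

(** * McCormick inequalities *)

(** The linear relaxation of [z = x * y] over the box [a, b] x [c, e]. *)
Definition mccormick (R : realDomainType) (a b c e x y z : R) :=
  [/\ z >= a * y + x * c - a * c, z >= b * y + x * e - b * e,
      z <= b * y + x * c - b * c & z <= a * y + x * e - a * e].

(** The four differences are the products of [x - a] or [b - x] with [y - c] or
    [e - y]. *)
Lemma mccormick_valid (R : realDomainType) (a b c e x y : R) :
  a <= x <= b -> c <= y <= e -> mccormick a b c e x y (x * y).
Proof. by move=> /andP[ax xb] /andP[cy ye]; split; nra. Qed.

(** Each right-hand side depends on its bound [a] or [b] of [x] through a term
    [a * (y - c)] or [a * (y - e)], whose monotonicity is known when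
    [c <= y <= e]. *)
Lemma mccormick_relax (R : realDomainType) (a b a' b' c e x y z : R) :
  a <= a' -> b' <= b -> c <= y <= e ->
  mccormick a' b' c e x y z -> mccormick a b c e x y z.
Proof. by move=> aa bb /andP[cy ye] [h1 h2 h3 h4]; split; nra. Qed.

Section relaxation.
Context (R : realType) (d : nat) (Omega : bounded_domain R d).
Context (N : nat) (Q : 'I_N -> set 'rV[R]_d).
Context (U : completeNormedModType R) (iota : U -> L2 Omega).
Context (A : U -> dual U) (f : dual U).
Context (C : set (L2 Omega)) (w_l w_u : Linfty Omega) (wlo wup : 'I_N -> R).

Local Notation feasible := (McC_feasible Q iota A f C w_l w_u wlo wup).

Lemma step_functionM (z1 z2 : 'I_N -> R) : trivIset setT Q ->
  step_function Q z1 \* step_function Q z2 =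
  step_function Q (fun i => z1 i * z2 i).
Proof.
move=> tQ; apply/funext => x; rewrite /step_function /=.
have [[i Qi]|nQ] := pselect (exists i, Q i x).
  have out k : k != i -> \1_(Q k) x = 0 :> R.
    move=> ki; rewrite indicE memNset// => Qk.
    by move/eqP: ki; apply; apply: tQ => //; exists x.
  have at_i (z : 'I_N -> R) : \sum_(k < N) z k * \1_(Q k) x = z i.
    rewrite (bigD1 i)//= big1 ?addr0; last by move=> k /out->; rewrite mulr0.
    by rewrite indicE mem_set// mulr1.
  by rewrite !at_i.
have out (z : 'I_N -> R) : \sum_(k < N) z k * \1_(Q k) x = 0.
  rewrite big1// => k _; rewrite indicE memNset ?mulr0// => Qk.
  by apply: nQ; exists k.
by rewrite !out mulr0.
Qed.

Lemma McC_feasible_average (ulo uup : 'I_N -> R) (u : U) (w : L2 Omega) :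
  trivIset setT Q -> C w -> ae_between Omega w_l w_u w ->
  solves iota A f u (P_h Q (iota u) \* P_h Q w) ->
  (forall i, ulo i <= average Q (iota u) i <= uup i) ->
  (forall i, wlo i <= average Q w i <= wup i) ->
  feasible ulo uup (u, w, \row_i (average Q (iota u) i * average Q w i)).
Proof.
move=> tQ Cw bw sol ub wb; split=> //.
  rewrite /P_h step_functionM// in sol.
  rewrite (_ : (fun i => _) =
    (fun i => average Q (iota u) i * average Q w i))//.
  by apply/funext => i; rewrite mxE.
move=> i Pu Pw; rewrite mxE.
by have [] := mccormick_valid (ub i) (wb i).
Qed.

Lemma McC_feasible_relax (ulo uup ulo' uup' : 'I_N -> R) (u : U)
    (w : L2 Omega) (z : 'rV[R]_N) :
  (forall i, ulo i <= ulo' i) -> (forall i, uup' i <= uup i) ->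
  (forall i, wlo i <= average Q w i <= wup i) ->
  feasible ulo' uup' (u, w, z) -> feasible ulo uup (u, w, z).
Proof.
move=> lol upp wb [Cw bw sol bnd]; split=> // i Pu Pw.
have [h1 h2 h3 h4 /andP[h5 h6]] := bnd i.
have [] := mccormick_relax (lol i) (upp i) (wb i) (And4 h1 h2 h3 h4).
by split=> //; rewrite (le_trans (lol i) h5) (le_trans h6 (upp i)).
Qed.

(** The new bound is an attained extremum, and every feasible point obeys the
    old bound. *)
Lemma OBBT_step_tightens (ulo uup ulo' uup' : 'I_N -> R) :
  OBBT_step Q iota A f C w_l w_u wlo wup ulo uup ulo' uup' ->
  (forall i, ulo i <= ulo' i) /\ (forall i, uup' i <= uup i).
Proof.
case=> i [|] [[[[[u w] z] [_ _ _ bnd] /= E] _] eqi eqo].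
  split=> k; last by rewrite eqo.
  have [->|ki] := eqVneq k i; last by rewrite eqi.
  by have [_ _ _ _ /andP[+ _]] := bnd i; rewrite E.
split=> k; first by rewrite eqo.
have [->|ki] := eqVneq k i; last by rewrite eqi.
by have [_ _ _ _ /andP[_ +]] := bnd i; rewrite E.
Qed.

(** The point built from the true products is feasible for every relaxation
    whose bounds its averages obey, and a tightened bound is an extremum over a
    set which contains it. *)
Lemma OBBT_keeps_average (ulo uup : nat -> 'I_N -> R) (u : U) (w : L2 Omega) :
  trivIset setT Q -> C w -> ae_between Omega w_l w_u w ->
  solves iota A f u (P_h Q (iota u) \* P_h Q w) ->
  (forall i, wlo i <= average Q w i <= wup i) ->
  (forall i, ulo 0%N i <= average Q (iota u) i <= uup 0%N i) ->
  (forall n, OBBT_step Q iota A f C w_l w_u wlo wup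
    (ulo n) (uup n) (ulo n.+1) (uup n.+1)) ->
  forall n i, ulo n i <= average Q (iota u) i <= uup n i.
Proof.
move=> tQ Cw bw sol wb ub0 step; elim=> // n IH k.
have Fn := McC_feasible_average tQ Cw bw sol IH wb.
have /andP[IHl IHu] := IH k.
have [i [|] [[_ ext] eqi eqo]] := step n.
  rewrite eqo IHu andbT; have [->|ki] := eqVneq k i; last by rewrite eqi.
  by apply: ext; exists (u, w, \row_i (average Q (iota u) i * average Q w i)).
rewrite eqo IHl /=; have [->|ki] := eqVneq k i; last by rewrite eqi.
by apply: ext; exists (u, w, \row_i (average Q (iota u) i * average Q w i)).
Qed.

(** A control of finite total variation is in [BV], hence its averages obey
    their bounds and tightening only adds constraints on it; the other controls
    have an infinite objective. *)
Lemma OBBT_step_value (j : U -> L2 Omega -> R) (alpha : R)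
    (ulo uup ulo' uup' : 'I_N -> R) :
  0 < alpha ->
  (forall w : L2 Omega, C w -> ae_between Omega w_l w_u w -> BV Omega w ->
    forall i, wlo i <= average Q w i <= wup i) ->
  OBBT_step Q iota A f C w_l w_u wlo wup ulo uup ulo' uup' ->
  (McC_value Q iota A f C w_l w_u wlo wup j alpha ulo uup <=
   McC_value Q iota A f C w_l w_u wlo wup j alpha ulo' uup')%E.
Proof.
move=> alpha0 wb /OBBT_step_tightens[lol upp].
apply/ereal_infP => _ [[[u w] z] Fp <-] /=.
have [TVw|] := ltP (TV Omega w) +oo%E.
  apply: ereal_inf_lbound; exists (u, w, z) => //.
  have [Cw bw _ _] := Fp.
  exact: McC_feasible_relax lol upp (wb _ Cw bw (BV_of_TV_lty TVw)) Fp.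
rewrite leye_eq /objective => /eqP->.
by rewrite gt0_muley ?lte_fin// addey ?leey.
Qed.

End relaxation.

(** * The lower bound and its monotonicity *)

Unset Implicit Arguments.

Theorem theorem2p18 (R : realType) (d : nat) (Omega : bounded_domain R d)
    (U : completeNormedModType R) (iota : U -> L2 Omega)
    (A : U -> dual U) (f : dual U) (alpha : R)
    (j : U -> L2 Omega -> R) (C : set (L2 Omega))
    (u_l u_u : L2 Omega) (w_l w_u : Linfty Omega)
    (h : R) (N : nat) (Q : 'I_N -> set 'rV[R]_d)
    (ulo0 uup0 wlo wup : 'I_N -> R) (ulo uup : nat -> 'I_N -> R) :
  (0 < d)%N ->
  (* standing assumptions *)
  reflexive_space U ->
  compact_embedding iota ->
  linear_to_dual A -> bounded_to_dual A -> has_bounded_inverse A ->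
  0 < alpha ->
  lipschitz_on_bounded_sets j ->
  C !=set0 -> L2_bounded C -> L2_closed C -> L2_convex C ->
  (forall (u : U) (w : 'rV[R]_d -> R), BV Omega w ->
    in_dual iota (iota u \* w)) ->
  (forall w : L2 Omega, C w -> BV Omega w ->
    exists! u, solves iota A f u (iota u \* w)) ->
  (forall (u : U) (w : L2 Omega), BV Omega w -> C w ->
    solves iota A f u (iota u \* w) ->
    ae_between Omega u_l u_u (iota u) /\ ae_between Omega w_l w_u w) ->
  (* partition, discretized state equation, bounds on the cell averages *)
  cube_partition Omega h Q ->
  (forall w : 'rV[R]_d -> R, BV Omega w -> ae_between Omega w_l w_u w ->
    exists! u, solves iota A f u (P_h Q (iota u) \* P_h Q w)) ->
  (forall (w : L2 Omega) (u : U), C w -> ae_between Omega w_l w_u w ->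
    solves iota A f u (P_h Q (iota u) \* P_h Q w) ->
    forall i, ulo0 i <= average Q (iota u) i <= uup0 i /\
              wlo i <= average Q w i <= wup i) ->
  (* hypotheses of the theorem *)
  L2_weakly_sequentially_compact C ->
  OBBT_sequence Q iota A f C w_l w_u wlo wup ulo0 uup0 ulo uup ->
  let F0 := McC_feasible Q iota A f C w_l w_u wlo wup ulo0 uup0 in
  let m n := McC_value Q iota A f C w_l w_u wlo wup j alpha (ulo n) (uup n) in
  (forall (ubar : U) (wbar : L2 Omega) (ubar_h : U) (L_u : R),
    OCP_minimizer iota A f j alpha C ubar wbar ->
    solves iota A f ubar_h (P_h Q (iota ubar_h) \* P_h Q wbar) ->
    (forall w : L2 Omega, L_u.-lipschitz_[set u | (exists z, F0 (u, w, z)) \/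
                                       (u, w) = (ubar, wbar)]
                 (fun u => j u w : R^o)) ->
    forall n,
      (m n - (L_u * `|ubar - ubar_h|)%:E <= OCP_value iota A f j alpha C)%E) /\
  nondecreasing_seq m.
Proof.
move=> _ _ _ _ _ _ alpha0 _ _ _ _ _ _ _ OCP_bounds [_ tQ _ _].
move=> discrete_state avg_bounds _ [ulo0E uup0E steps] F0 m; split; last first.
  apply/nondecreasing_seqP => n; apply: OBBT_step_value alpha0 _ (steps n).
  move=> w Cw bw BVw i; have [u [sol _]] := discrete_state w BVw bw.
  by have [] := avg_bounds w u Cw bw sol i.
move=> ubar wbar ubar_h L_u [[/= Cw BVw sol] opt] sol_h lip n.
have [_ bw] := OCP_bounds _ _ BVw Cw sol.
have ub i := (avg_bounds _ _ Cw bw sol_h i).1.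
have wb i := (avg_bounds _ _ Cw bw sol_h i).2.
have F0h := McC_feasible_average tQ Cw bw sol_h ub wb.
have ub0 i : ulo 0%N i <= average Q (iota ubar_h) i <= uup 0%N i.
  by rewrite ulo0E uup0E.
have ubn := OBBT_keeps_average tQ Cw bw sol_h wb ub0 steps n.
apply: (@le_trans _ _ (objective j alpha ubar wbar)); last first.
  by apply/ereal_infP => _ [p Fp <-]; exact: opt.
rewrite EFinN leeBlDr//.
apply: (@le_trans _ _ (objective j alpha ubar_h wbar)).
  apply: ereal_inf_lbound.
  exists (ubar_h, wbar,
    \row_i (average Q (iota ubar_h) i * average Q wbar i)) => //.
  exact: McC_feasible_average.
rewrite /objective addeAC leeD2r// -EFinD lee_fin -lerBlDl distrC.
have /= := lip wbar (ubar_h, ubar); rewrite distrC => jL.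
apply: le_trans (ler_norm _) (jL _); split=> /=; last by right.
by left; eexists; exact: F0h.
Qed.
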